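(* The set $\forall\mathrm{FO}$ of universal first-order sentences is superfluous with respect to $\Sigma_2^p$: for every vocabulary $\tau$, every second-order sentence $\Psi$ over $\tau$ of the form $\exists\vec R_1\forall\vec R_2\,\varphi$ ($\varphi$ first order) and every universal first-order sentence $\psi$ over $\tau$, if $\mathrm{MOD}[\Psi\wedge\psi]$ is $\Sigma_2^p$-complete then $\mathrm{MOD}[\Psi]$ is $\Sigma_2^p$-complete.
   Context: Conventions: vocabularies implicitly contain numeric symbols $\le$, BIT, PLUS, TIMES, SUC, $0,1,\max$; finite structures have universe $\{0,\dots,n-1\}$ with standard interpretations of numeric symbols; MOD$[\Phi]$ is the set of finite models of $\Phi$; a formula is numeric if it uses only numeric symbols. A universal first-order sentence is one of the form $\forall x_1\dots\forall x_k\,\theta$ with $\theta$ quantifier-free. $\Sigma_2^p$ is the class of problems MOD$[\Phi]$ with $\Phi$ of the form $\exists\vec R_1\forall\vec R_2\,\varphi$, $\varphi$ first order. A $k$-ary first-order query from STRUC$[\tau]$ to STRUC$[\sigma]$ ($\sigma=\langle R_1^{a_1},\dots,R_r^{a_r},c_1,\dots,c_s\rangle$) is a tuple $\langle\varphi_0,\varphi_1,\dots,\varphi_r,\psi_1,\dots,\psi_s\rangle$ of first-order $\tau$-formulas mapping $\mathcal A$ to the structure with universe $\{\vec b\in|\mathcal A|^k:\mathcal A\models\varphi_0(\vec b)\}$, $R_i$ defined by $\varphi_i$, $c_j$ the unique tuple satisfying $\psi_j$; it is a first-order projection (fop) if $\varphi_0$ is numeric and each $\varphi_i,\psi_j$ has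 the form $\alpha_0\vee(\alpha_1\wedge\lambda_1)\vee\dots\vee(\alpha_\ell\wedge\lambda_\ell)$ with $\alpha_t$ numeric mutually exclusive and $\lambda_t$ $\tau$-literals. $B$ is $\Sigma_2^p$-complete if $B\in\Sigma_2^p$ and for every $A\in\Sigma_2^p$ there is a fop $I$ with $\mathcal A\in A\iff I(\mathcal A)\in B$. *)

(* Defs.v *)
From mathcomp Require Import all_boot all_order.

Set Implicit Arguments.
Unset Strict Implicit.
Unset Printing Implicit Defensive.

(* The numeric symbols are not part of the record: they are built into the
   syntax of terms and formulas over every vocabulary. *)
Record vocab := Vocab {
  rsym : finType;
  arity : rsym -> nat;
  csym : finType }.

(* The universe is {0, ..., card - 1}.  At least two elements are required so
   that the numeric constant 1 denotes an element of the universe. *)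
Record struc (tau : vocab) := Struc {
  card : nat;
  card_gt1 : 1 < card;
  rel : forall R : rsym tau, {set (arity R).-tuple 'I_card};
  cst : csym tau -> 'I_card }.

Section FirstOrder.
Variable tau : vocab.

Inductive term (V : Type) : Type :=
| Var of V
| Cst of csym tau
| Zero
| One
| Max.

(* [fo V] is the type of first-order formulas with free variables in [V]; a
   quantifier binds the variable [None : option V]. *)
Inductive fo (V : Type) : Type :=
| Rel (R : rsym tau) of (arity R).-tuple (term V)
| Eq of term V & term V
| Le of term V & term V
| Bit of term V & term V
| Suc of term V & term V
| Plus of term V & term V & term V
| Times of term V & term V & term V
| Not of fo V
| And of fo V & fo V
| Or of fo V & fo V
| All of fo (option V)
| Ex of fo (option V).

Section Semantics.
Variable A : struc tau.

Definition eval (V : Type) (e : V -> 'I_(card A)) (t : term V) : 'I_(card A) :=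
  match t with
  | Var v => e v
  | Cst c => cst A c
  | Zero => Ordinal (ltnW (card_gt1 A))
  | One => Ordinal (card_gt1 A)
  | Max => rev_ord (Ordinal (ltnW (card_gt1 A)))
  end.

(* BIT(x, y): bit y of the binary representation of x is 1 (bit 0 is the least
   significant one).  PLUS, TIMES and SUC are the graphs of the operations on
   natural numbers, without wrap-around. *)
Fixpoint sat (V : Type) (phi : fo V) : (V -> 'I_(card A)) -> bool :=
  match phi with
  | Rel R ts => fun e => map_tuple (eval e) ts \in rel A R
  | Eq s t => fun e => eval e s == eval e t
  | Le s t => fun e => eval e s <= eval e t
  | Bit s t => fun e => odd (eval e s %/ 2 ^ eval e t)
  | Suc s t => fun e => (eval e s).+1 == eval e t
  | Plus s t u => fun e => eval e s + eval e t == eval e u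
  | Times s t u => fun e => eval e s * eval e t == eval e u
  | Not f => fun e => ~~ sat f e
  | And f g => fun e => sat f e && sat g e
  | Or f g => fun e => sat f e || sat g e
  | All f => fun e => [forall x, sat f (oapp e x)]
  | Ex f => fun e => [exists x, sat f (oapp e x)]
  end.

End Semantics.

Definition numeric_term (V : Type) (t : term V) : bool :=
  if t is Cst _ then false else true.

Fixpoint numeric (V : Type) (phi : fo V) : bool :=
  match phi with
  | Rel _ _ => false
  | Eq s t | Le s t | Bit s t | Suc s t => numeric_term s && numeric_term t
  | Plus s t u | Times s t u =>
      [&& numeric_term s, numeric_term t & numeric_term u]
  | Not f => numeric f
  | And f g | Or f g => numeric f && numeric g
  | All f | Ex f => numeric f
  end.

Fixpoint quantifier_free (V : Type) (phi : fo V) : bool :=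
  match phi with
  | Not f => quantifier_free f
  | And f g | Or f g => quantifier_free f && quantifier_free g
  | All _ | Ex _ => false
  | _ => true
  end.

Fixpoint universal (V : Type) (phi : fo V) : bool :=
  if phi is All f then universal f else quantifier_free phi.

Definition atomic (V : Type) (phi : fo V) : bool :=
  match phi with
  | Not _ | And _ _ | Or _ _ | All _ | Ex _ => false
  | _ => true
  end.

Definition literal (V : Type) (phi : fo V) : bool :=
  if phi is Not f then atomic f else atomic phi.

Definition mutually_exclusive (V : Type) (alphas : seq (fo V)) : Prop :=
  forall (A : struc tau) (e : V -> 'I_(card A)),
    pairwise (fun alpha beta => ~~ (sat alpha e && sat beta e)) alphas.

(* alpha_0 \/ (alpha_1 /\ lambda_1) \/ ... \/ (alpha_l /\ lambda_l), where the
   list s consists of the pairs (alpha_t, lambda_t). *)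
Definition is_projection (V : Type) (phi : fo V) : Prop :=
  exists (alpha0 : fo V) (s : seq (fo V * fo V)),
    [/\ phi = foldl (fun f p => Or f (And p.1 p.2)) alpha0 s,
        all (@numeric V) (alpha0 :: map fst s),
        mutually_exclusive (alpha0 :: map fst s)
      & all (@literal V) (map snd s)].

End FirstOrder.

Arguments Zero {tau V}.
Arguments One {tau V}.
Arguments Max {tau V}.

(* Adding a vector of m fresh relation symbols of arities a 0, ..., a (m-1). *)
Definition expand_vocab (tau : vocab) (m : nat) (a : 'I_m -> nat) : vocab :=
  @Vocab (rsym tau + 'I_m)%type
    (fun s => match s with inl R => arity R | inr i => a i end) (csym tau).

Definition expand (tau : vocab) (m : nat) (a : 'I_m -> nat) (A : struc tau)
    (X : forall i, {set (a i).-tuple 'I_(card A)}) : struc (expand_vocab tau a) :=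
  @Struc (expand_vocab tau a) (card A) (card_gt1 A)
    (fun s => match s return {set (@arity (expand_vocab tau a) s).-tuple _} with
              | inl R => rel A R
              | inr i => X i
              end)
    (@cst tau A).

(* Second-order sentences; the second-order quantifiers bind vectors of
   relation variables. *)
Inductive so (tau : vocab) : Type :=
| FO of fo tau void
| SNot of so tau
| SAnd of so tau & so tau
| SEx (m : nat) (a : 'I_m -> nat) of so (expand_vocab tau a)
| SAll (m : nat) (a : 'I_m -> nat) of so (expand_vocab tau a).

Fixpoint models (tau : vocab) (Psi : so tau) : struc tau -> Prop :=
  match Psi with
  | FO phi => fun A => sat phi (@of_void 'I_(card A))
  | SNot f => fun A => ~ models f A
  | SAnd f g => fun A => models f A /\ models g A
  | SEx m a f => fun A =>
      exists X : forall i, {set (a i).-tuple 'I_(card A)}, models f (expand X)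
  | SAll m a f => fun A =>
      forall X : forall i, {set (a i).-tuple 'I_(card A)}, models f (expand X)
  end.

Definition problem (tau : vocab) := struc tau -> Prop.

Definition MOD (tau : vocab) (Psi : so tau) : problem tau := models Psi.

Definition Sigma2_form (tau : vocab) (Psi : so tau) : Prop :=
  exists (m1 : nat) (a1 : 'I_m1 -> nat) (m2 : nat) (a2 : 'I_m2 -> nat)
         (phi : fo (expand_vocab (expand_vocab tau a1) a2) void),
    Psi = SEx (SAll (FO phi)).

Definition Sigma2p (tau : vocab) (P : problem tau) : Prop :=
  exists2 Phi : so tau, Sigma2_form Phi & forall A, P A <-> MOD Phi A.

Section Queries.
Variables tau sigma : vocab.

Definition dom_set (k : nat) (phi0 : fo tau 'I_k) (A : struc tau)
    : {set k.-tuplelexi 'I_(card A)} :=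
  [set b : k.-tuplelexi 'I_(card A) | sat phi0 (tnth b)].

(* The universe of the image is identified with an initial segment of the
   natural numbers through the lexicographic order on k-tuples. *)
Definition dom_elt (k : nat) (phi0 : fo tau 'I_k) (A : struc tau)
    (i : 'I_#|dom_set phi0 A|) : k.-tuple 'I_(card A) :=
  Order.enum_val i.

(* A k-ary first-order query.  The free variable (i, l) of q_rel R is the l-th
   coordinate of the i-th argument of R.  The last two fields say that the
   query maps every structure to a structure. *)
Record query (k : nat) := Query {
  q_dom : fo tau 'I_k;
  q_rel : forall R : rsym sigma, fo tau ('I_(arity R) * 'I_k);
  q_cst : csym sigma -> fo tau 'I_k;
  q_dom_gt1 : forall A, 1 < #|dom_set q_dom A|;
  q_cst_uniq : forall (A : struc tau) (c : csym sigma),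
    exists! b, b \in dom_set q_dom A /\ sat (q_cst c) (tnth b) }.

(* By q_cst_uniq, the default value in the interpretation of the constants is
   never used. *)
Definition image (k : nat) (I : query k) (A : struc tau) : struc sigma :=
  @Struc sigma #|dom_set (q_dom I) A| (q_dom_gt1 I A)
    (fun R => [set t : (arity R).-tuple 'I_#|dom_set (q_dom I) A| |
       sat (q_rel I R) (fun p => tnth (dom_elt (tnth t p.1)) p.2)])
    (fun c => odflt (Ordinal (q_dom_gt1 I A))
       [pick i : 'I_#|dom_set (q_dom I) A| | sat (q_cst I c) (tnth (dom_elt i))]).

Definition is_fop (k : nat) (I : query k) : Prop :=
  [/\ numeric (q_dom I),
      forall R, is_projection (q_rel I R)
    & forall c, is_projection (q_cst I c)].

End Queries.

Definition Sigma2p_complete (sigma : vocab) (B : problem sigma) : Prop :=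
  Sigma2p B /\
  forall (tau : vocab) (P : problem tau), Sigma2p P ->
    exists (k : nat) (I : query tau sigma k),
      is_fop I /\ forall A, P A <-> B (image I A).

(* Main.v *)
From mathcomp Require Import all_boot all_order.
From Stdlib Require Import FunctionalExtensionality.
Require Import Defs.

Set Implicit Arguments.
Unset Strict Implicit.
Unset Printing Implicit Defensive.

(* A violation of the universal sentence [psi] in the image of a structure
   under a fop involves boundedly many atoms and constants of the image, and
   each of them depends on at most one literal of the source.  The bound m
   depends on [psi] only.  Given a problem P in Sigma_2^p, add more than m fresh
   0-ary relations ("flags") and let P' hold of a structure when P holds or some
   flag is raised.  P' is in Sigma_2^p, so it has a fop I to MOD[Psi /\ psi].  If
   I(A, no flags) violated [psi], the violation would not depend on some flag,
   hence would persist after raising it, whereas (A, one flag) is in P'.  So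
   A |-> I(A, no flags) always satisfies [psi] and reduces P to MOD[Psi]. *)

(** * Substituting formulas for relation atoms *)

Section Translation.
Variables (tau sigma : vocab) (h : csym tau -> csym sigma).
(** [H] is polymorphic in [V] because [trans] goes below quantifiers, where the type of variables
    changes. *)
Variable H : forall (V : Type) (R : rsym tau), (arity R).-tuple (term sigma V) -> fo sigma V.

Definition trans_term (V : Type) (t : term tau V) : term sigma V :=
  match t with
  | Var v => Var sigma v
  | Cst c => Cst V (h c)
  | Zero => Zero
  | One => One
  | Max => Max
  end.

Fixpoint trans (V : Type) (phi : fo tau V) : fo sigma V :=
  match phi with
  | Rel R ts => H (map_tuple (@trans_term V) ts)
  | Eq s t => Eq (trans_term s) (trans_term t)
  | Le s t => Le (trans_term s) (trans_term t)
  | Bit s t => Bit (trans_term s) (trans_term t)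
  | Suc s t => Suc (trans_term s) (trans_term t)
  | Plus s t u => Plus (trans_term s) (trans_term t) (trans_term u)
  | Times s t u => Times (trans_term s) (trans_term t) (trans_term u)
  | Not f => Not (trans f)
  | And f g => And (trans f) (trans g)
  | Or f g => Or (trans f) (trans g)
  | All f => All (trans f)
  | Ex f => Ex (trans f)
  end.

Lemma numeric_term_trans V (t : term tau V) :
  numeric_term (trans_term t) = numeric_term t.
Proof. by case: t. Qed.

Lemma numeric_trans V (phi : fo tau V) : numeric phi -> numeric (trans phi).
Proof.
elim: phi => //= {V} V.
- by move=> s t; rewrite !numeric_term_trans.
- by move=> s t; rewrite !numeric_term_trans.
- by move=> s t; rewrite !numeric_term_trans.
- by move=> s t; rewrite !numeric_term_trans.
- by move=> s t u; rewrite !numeric_term_trans.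
- by move=> s t u; rewrite !numeric_term_trans.
- by move=> f IHf g IHg /andP[/IHf-> /IHg->].
- by move=> f IHf g IHg /andP[/IHf-> /IHg->].
Qed.

Lemma literal_trans V (phi : fo tau V) :
    (forall R (ts : (arity R).-tuple (term sigma V)), atomic (H ts)) ->
  literal phi -> literal (trans phi).
Proof.
move=> atH.
have litA (f : fo sigma V) : atomic f -> literal f by case: f.
by case: phi => //= [R ts _|[]//=]; first exact/litA/atH.
Qed.

Variables (B : struc sigma).
Variable r : forall R : rsym tau, {set (arity R).-tuple 'I_(card B)}.
Variable c : csym tau -> 'I_(card B).
Hypothesis rH : forall (V : Type) (R : rsym tau) (ts : (arity R).-tuple (term sigma V)) e,
  sat (H ts) e = (map_tuple (@eval sigma B V e) ts \in r R).
Hypothesis ch : forall k, cst B (h k) = c k.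

Let A : struc tau := Struc (card_gt1 B) r c.

Lemma eval_trans V (t : term tau V) (e : V -> 'I_(card B)) :
  @eval sigma B V e (trans_term t) = @eval tau A V e t.
Proof. by case: t => //= k. Qed.

Lemma sat_trans V (phi : fo tau V) (e : V -> 'I_(card B)) :
  @sat sigma B V (trans phi) e = @sat tau A V phi e.
Proof.
elim: phi e => {V} V.
- move=> R ts e /=; rewrite rH; apply: (congr1 (fun u => u \in r R)).
  by apply/val_inj; rewrite /= -map_comp; apply: eq_map => t /=; rewrite eval_trans.
- by move=> s t e /=; rewrite !eval_trans.
- by move=> s t e /=; rewrite !eval_trans.
- by move=> s t e /=; rewrite !eval_trans.
- by move=> s t e /=; rewrite !eval_trans.
- by move=> s t u e /=; rewrite !eval_trans.
- by move=> s t u e /=; rewrite !eval_trans.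
- by move=> f IH e /=; rewrite IH.
- by move=> f IHf g IHg e /=; rewrite IHf IHg.
- by move=> f IHf g IHg e /=; rewrite IHf IHg.
- by move=> f IH e /=; apply: eq_forallb => x; exact: (IH (oapp e x)).
- by move=> f IH e /=; apply: eq_existsb => x; exact: (IH (oapp e x)).
Qed.

End Translation.

(** * Evaluating numeric formulas and projections *)

Lemma sat_numeric (tau : vocab) n (gt1 : 1 < n)
    (r1 r2 : forall R : rsym tau, {set (arity R).-tuple 'I_n})
    (c1 c2 : csym tau -> 'I_n) V (phi : fo tau V) (e : V -> 'I_n) :
  numeric phi ->
  @sat tau (Struc gt1 r1 c1) V phi e = @sat tau (Struc gt1 r2 c2) V phi e.
Proof.
have evalE W (t : term tau W) (f : W -> 'I_n) : numeric_term t ->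
    @eval tau (Struc gt1 r1 c1) W f t = @eval tau (Struc gt1 r2 c2) W f t.
  by case: t.
elim: phi e => {V} V //=.
- by move=> s t e /andP[? ?]; rewrite !evalE.
- by move=> s t e /andP[? ?]; rewrite !evalE.
- by move=> s t e /andP[? ?]; rewrite !evalE.
- by move=> s t e /andP[? ?]; rewrite !evalE.
- by move=> s t u e /and3P[? ? ?]; rewrite !evalE.
- by move=> s t u e /and3P[? ? ?]; rewrite !evalE.
- by move=> f IH e nf; rewrite IH.
- by move=> f IHf g IHg e /andP[nf ng]; rewrite IHf ?IHg.
- by move=> f IHf g IHg e /andP[nf ng]; rewrite IHf ?IHg.
- by move=> f IH e nf; apply: eq_forallb => x; exact: (IH (oapp e x)).
- by move=> f IH e nf; apply: eq_existsb => x; exact: (IH (oapp e x)).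
Qed.

Lemma sat_foldl_Or (tau : vocab) (A : struc tau) V (alpha0 : fo tau V)
    (s : seq (fo tau V * fo tau V)) e :
  @sat tau A V (foldl (fun f p => Or f (And p.1 p.2)) alpha0 s) e =
  sat alpha0 e || has (fun p => sat p.1 e && sat p.2 e) s.
Proof.
by elim: s alpha0 => [|p s IHs] alpha0 /=; rewrite ?orbF // IHs /= orbA.
Qed.

(** * Persistence of universal formulas in a family of structures *)

Section Persistence.
Variables (sigma : vocab) (m n : nat) (gt1 : 1 < n).
Variable r : option 'I_m -> forall R : rsym sigma, {set (arity R).-tuple 'I_n}.
Variable c : option 'I_m -> csym sigma -> 'I_n.

Let S o : struc sigma := Struc gt1 (r o) (c o).

(** Index [None] is the base structure and [Some i] its i-th variant. For a fixed tuple at most one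
    variant changes the truth value; [j = None] allows no change at all. *)
Hypothesis r_dep : forall R t, exists j : option 'I_m,
  forall i, Some i != j -> (t \in r (Some i) R) = (t \in r None R).
Hypothesis c_dep : forall k, exists j : option 'I_m,
  forall i, Some i != j -> c (Some i) k = c None k.

(** Quantifiers leave the count unchanged: a violation of a universal formula fixes one value for
    each variable, so the bound does not depend on [n]. *)
Fixpoint nb_rel (V : Type) (phi : fo sigma V) : nat :=
  match phi with
  | Rel _ _ => 1
  | Not f | All f | Ex f => nb_rel f
  | And f g | Or f g => nb_rel f + nb_rel g
  | _ => 0
  end.

Lemma cst_persist : exists2 L : {set 'I_m}, #|L| <= #|csym sigma|
  & forall i, i \notin L -> forall k, c (Some i) k = c None k.
Proof.
have [f fP] := fin_all_exists c_dep.
exists [set i | Some i \in f @: setT].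
  rewrite -(card_imset _ (@Some_inj _)) -cardsT.
  apply: leq_trans (leq_imset_card f _); apply/subset_leq_card/subsetP => o.
  by case/imsetP=> i; rewrite inE => fi ->.
move=> i; rewrite inE => fi k; apply: fP.
by apply: contraNneq fi => ->; apply: imset_f.
Qed.

(** A constant may occur in many atoms, so the variants that change constants are set aside once, in
    [L0]. Outside [L0], each relation atom excludes at most one more variant. *)
Lemma qf_persist (L0 : {set 'I_m}) V (phi : fo sigma V) (e : V -> 'I_n) :
    (forall i, i \notin L0 -> forall k, c (Some i) k = c None k) ->
    quantifier_free phi ->
  exists2 L : {set 'I_m}, #|L| <= nb_rel phi
  & forall i, i \notin L0 :|: L ->
      @sat sigma (S (Some i)) V phi e = @sat sigma (S None) V phi e.
Proof.
move=> cL0.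
have evalE W (t : term sigma W) (f : W -> 'I_n) i : i \notin L0 ->
    @eval sigma (S (Some i)) W f t = @eval sigma (S None) W f t.
  by case: t => //= k /cL0.
have binary W (f g : fo sigma W) (d : W -> 'I_n) :
    (exists2 L : {set 'I_m}, #|L| <= nb_rel f & forall i, i \notin L0 :|: L ->
      @sat sigma (S (Some i)) W f d = @sat sigma (S None) W f d) ->
    (exists2 L : {set 'I_m}, #|L| <= nb_rel g & forall i, i \notin L0 :|: L ->
      @sat sigma (S (Some i)) W g d = @sat sigma (S None) W g d) ->
    exists2 L : {set 'I_m}, #|L| <= nb_rel f + nb_rel g &
      forall i, i \notin L0 :|: L ->
      @sat sigma (S (Some i)) W f d = @sat sigma (S None) W f d /\
      @sat sigma (S (Some i)) W g d = @sat sigma (S None) W g d.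
  move=> [L1 leL1 L1P] [L2 leL2 L2P]; exists (L1 :|: L2).
    by rewrite cardsU (leq_trans (leq_subr _ _)) ?leq_add.
  by move=> i; rewrite !inE !negb_or => /and3P[i0 i1 i2];
     rewrite L1P ?L2P // !inE negb_or i0.
elim: phi e => {V} V //=.
- move=> R ts e _.
  (* Outside [L0] all terms keep their values from [S None], so the variants are asked about this
     same tuple. *)
  have [j jP] := r_dep (map_tuple (@eval sigma (S None) V e) ts).
  exists [set i | Some i == j].
    case: {jP} j => [j|].
      rewrite (_ : [set i | _] = [set j]) ?cards1 //.
      by apply/setP=> i; rewrite !inE.
    by rewrite (_ : [set i | _] = set0) ?cards0 //; apply/setP=> i; rewrite !inE.
  move=> i; rewrite !inE negb_or => /andP[i0 /jP <-].
  apply: (congr1 (fun u => u \in r (Some i) R)); apply/val_inj/eq_map => t.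
  exact: evalE.
all: try by move=> *; exists set0; rewrite ?cards0 // => i; rewrite setU0 => i0;
  rewrite !evalE.
- by move=> f IH e qf; have [L ? LP] := IH e qf; exists L => // i /LP ->.
- move=> f IHf g IHg e /andP[qf qg].
  by have [L ? LP] := binary _ _ _ _ (IHf e qf) (IHg e qg); exists L => // i /LP[-> ->].
- move=> f IHf g IHg e /andP[qf qg].
  by have [L ? LP] := binary _ _ _ _ (IHf e qf) (IHg e qg); exists L => // i /LP[-> ->].
Qed.

(** Once the variables have values, fewer than [m] variants are excluded, and any remaining one
    agrees with the base structure. Which one remains may depend on these values. *)
Lemma universal_persist V (phi : fo sigma V) (e : V -> 'I_n) :
    universal phi -> #|csym sigma| + nb_rel phi < m ->
    (forall i, @sat sigma (S (Some i)) V phi e) ->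
  @sat sigma (S None) V phi e.
Proof.
have [L0 leL0 cL0] := cst_persist.
have qf W (f : fo sigma W) (d : W -> 'I_n) : quantifier_free f ->
    #|csym sigma| + nb_rel f < m -> (forall i, @sat sigma (S (Some i)) W f d) ->
    @sat sigma (S None) W f d.
  move=> qff ltm satf; have [L leL LP] := qf_persist d cL0 qff.
  have /subsetPn[i _ /LP <- //] : ~~ ([set: 'I_m] \subset L0 :|: L).
  apply/negP => /subset_leq_card; rewrite cardsT card_ord leqNgt => /negP; apply.
  apply: leq_ltn_trans ltm.
  by rewrite cardsU (leq_trans (leq_subr _ _)) ?leq_add.
elim: phi e => {V} V; try by move=> *; apply: qf.
move=> f IH e uf ltm satf; apply/forallP => x; apply: IH => // i.
by have /forallP := satf i; apply.
Qed.

End Persistence.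

(** * Images of a query with a given domain *)

Section Image.
Variables (sigma : vocab) (n k : nat) (D : {set k.-tuplelexi 'I_n}).
Variable gt1 : 1 < #|D|.
Variable pr : forall R : rsym sigma, ('I_(arity R) * 'I_k -> 'I_n) -> bool.
Variable pc : csym sigma -> ('I_k -> 'I_n) -> bool.

Definition elt_on (i : 'I_#|D|) : k.-tuple 'I_n := Order.enum_val i.

Definition rel_on (R : rsym sigma) : {set (arity R).-tuple 'I_#|D|} :=
  [set t : (arity R).-tuple 'I_#|D| | pr (fun p => tnth (elt_on (tnth t p.1)) p.2)].

Definition cst_on (c : csym sigma) : 'I_#|D| :=
  odflt (Ordinal gt1) [pick i : 'I_#|D| | pc c (tnth (elt_on i))].

(* The common shape of the images of structures with the same universe; unlike
   [image], it lets images with equal domains share their universe. *)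
Definition image_on : struc sigma := Struc gt1 rel_on cst_on.

End Image.

Lemma eq_image_on (sigma : vocab) n k (D1 D2 : {set k.-tuplelexi 'I_n})
    (gt1 : 1 < #|D1|) (gt2 : 1 < #|D2|)
    (pr1 pr2 : forall R : rsym sigma, ('I_(arity R) * 'I_k -> 'I_n) -> bool)
    (pc1 pc2 : csym sigma -> ('I_k -> 'I_n) -> bool) :
    D1 = D2 -> (forall R f, pr1 R f = pr2 R f) -> (forall c f, pc1 c f = pc2 c f) ->
  image_on gt1 pr1 pc1 = image_on gt2 pr2 pc2.
Proof.
(* Identifying [D2] with [D1] first turns the two universes into the same type. *)
move=> eqD eqr eqc; case: _ / eqD gt2 => gt2; rewrite (eq_irrelevance gt2 gt1).
have -> : pr1 = pr2.
  by apply: functional_extensionality_dep => R; apply: functional_extensionality.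
suff -> : pc1 = pc2 by [].
by apply: functional_extensionality => c; apply: functional_extensionality.
Qed.

(** * Structures with flags *)

Section Flags.
Variables (tau : vocab) (m : nat).

Definition flagged : vocab := @expand_vocab tau m (fun=> 0).

(* [raise A None] raises no flag, [raise A (Some i)] raises only the i-th one. *)
Definition raise (A : struc tau) (o : option 'I_m) : struc flagged :=
  @expand tau m (fun=> 0) A (fun i => if o == Some i then setT else set0).

Lemma sat_raise_numeric A V (phi : fo flagged V) (e : V -> 'I_(card A)) o1 o2 :
  numeric phi ->
  @sat flagged (raise A o1) V phi e = @sat flagged (raise A o2) V phi e.
Proof. exact: sat_numeric. Qed.

(** A literal sees a flag only if it is the atom of that flag or its negation. *)
Lemma sat_raise_literal A V (phi : fo flagged V) (e : V -> 'I_(card A)) :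
  literal phi -> exists j : option 'I_m, forall i, Some i != j ->
    @sat flagged (raise A (Some i)) V phi e = @sat flagged (raise A None) V phi e.
Proof.
have at_dep (f : fo flagged V) : atomic f -> exists j : option 'I_m,
    forall i, Some i != j ->
    @sat flagged (raise A (Some i)) V f e = @sat flagged (raise A None) V f e.
  case: f => //; try by exists None.
  case=> [R|j] ts _; first by exists None.
  by exists (Some j) => i /= /negPf->.
case: phi => //; try by move=> *; apply: at_dep.
by move=> f /at_dep[j jP]; exists j => i /jP /= ->.
Qed.

(** The numeric guards do not see the flags, and at most one of them holds at [e], so the truth
    value hangs on at most one literal. *)
Lemma sat_raise_projection A V (phi : fo flagged V) (e : V -> 'I_(card A)) :
  is_projection phi -> exists j : option 'I_m, forall i, Some i != j ->
    @sat flagged (raise A (Some i)) V phi e = @sat flagged (raise A None) V phi e.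
Proof.
pose holds o f := @sat flagged (raise A o) V f e.
case=> alpha0 [s [-> /= /andP[num0 nums] /(_ (raise A None) e) /= /andP[_ excl] lits]].
suff [j jP] : exists j : option 'I_m, forall i, Some i != j ->
    has (fun p => holds (Some i) p.1 && holds (Some i) p.2) s =
    has (fun p => holds None p.1 && holds None p.2) s.
  exists j => i ij; rewrite !sat_foldl_Or jP //.
  by rewrite (sat_raise_numeric _ _ None num0).
elim: s nums excl lits => [|[alpha l] s IHs] /=; first by exists None.
move=> /andP[numa nums] /andP[exa excl] /andP[litl lits].
have numE o f : numeric f -> holds o f = holds None f by exact: sat_raise_numeric.
have [sata|nsata] := boolP (holds None alpha); last first.
  have [j jP] := IHs nums excl lits.
  by exists j => i /jP IH; rewrite numE // (negPf nsata).
(* Since [alpha] holds, every later guard fails, whichever flag is raised. *)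
have others o : has (fun p => holds o p.1 && holds o p.2) s = false.
  elim: s nums exa {IHs excl lits} => //= p s IHs /andP[nump nums] /andP[exp exs].
  rewrite IHs // orbF numE //; move: exp.
  by rewrite -/(holds None alpha) sata /= => /negPf; rewrite -/(holds None p.1) => ->.
have [j jP] := sat_raise_literal e litl.
by exists j => i /jP lE; rewrite numE // sata /= !others !orbF; exact: lE.
Qed.

(** [Eq Zero One] is false because universes have at least two elements; it is an atom, so literals
    are mapped to literals. *)
Definition lower V (phi : fo flagged V) : fo tau V :=
  @trans flagged tau id
    (fun W R => match R with
       | inl R => fun ts : (arity R).-tuple (term tau W) => Rel ts
       | inr _ => fun=> Eq Zero One
       end) V phi.

Lemma sat_lower A V (phi : fo flagged V) (e : V -> 'I_(card A)) :
  @sat tau A V (lower phi) e = @sat flagged (raise A None) V phi e.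
Proof.
rewrite /lower (@sat_trans _ _ _ _ A
  (@rel flagged (raise A None)) (@cst flagged (raise A None))) //.
by move=> W [R|i] ts f //=; rewrite inE; apply/negbTE.
Qed.

Lemma numeric_lower V (phi : fo flagged V) : numeric phi -> numeric (lower phi).
Proof. exact: numeric_trans. Qed.

Lemma lower_projection V (phi : fo flagged V) :
  is_projection phi -> is_projection (lower phi).
Proof.
case=> alpha0 [s [-> nums excl lits]].
exists (lower alpha0), [seq (lower p.1, lower p.2) | p <- s].
have alphasE : lower alpha0 :: map fst [seq (lower p.1, lower p.2) | p <- s] =
    map (@lower V) (alpha0 :: map fst s) by rewrite /= -!map_comp.
split.
- by elim: s alpha0 {nums excl lits alphasE} => //= p s IHs alpha0; rewrite IHs.
- rewrite alphasE all_map; apply: sub_all nums => alpha; exact: numeric_lower.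
(* Mutual exclusion in [A] is inherited from [A] with no flag raised. *)
- rewrite alphasE => A e; rewrite pairwise_map.
  by apply: sub_pairwise (excl (raise A None) e) => f g /=; rewrite !sat_lower.
- rewrite -map_comp all_map; rewrite all_map in lits.
  by apply: sub_all lits => p /=; apply: literal_trans => -[].
Qed.

(** * The reduction with no flag raised *)

Section Reduction.
Variables (sigma : vocab) (k : nat) (I : query flagged sigma k).
Hypothesis fopI : is_fop I.

Let D (A : struc tau) := dom_set (q_dom I) (raise A None).

Lemma dom_raise A o : dom_set (q_dom I) (raise A o) = D A.
Proof.
case: fopI => numI _ _.
by apply/setP=> b; rewrite !inE; apply: sat_raise_numeric.
Qed.

Lemma dom_lower A : dom_set (lower (q_dom I)) A = D A.
Proof. by apply/setP=> b; rewrite !inE sat_lower. Qed.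

Lemma lower_dom_gt1 A : 1 < #|dom_set (lower (q_dom I)) A|.
Proof. by rewrite dom_lower; exact: (q_dom_gt1 I (raise A None)). Qed.

Lemma lower_cst_uniq A c : exists! b,
  b \in dom_set (lower (q_dom I)) A /\ sat (lower (q_cst I c)) (tnth b).
Proof.
rewrite dom_lower; have [b [[Db satb] uniqb]] := q_cst_uniq I (raise A None) c.
exists b; split; first by split=> //; rewrite sat_lower.
by move=> b' [Db' satb']; apply: uniqb; rewrite sat_lower in satb'.
Qed.

Definition lower_query : query tau sigma k :=
  @Query tau sigma k _ (fun R => lower (q_rel I R)) (fun c => lower (q_cst I c))
    lower_dom_gt1 lower_cst_uniq.

Lemma lower_fop : is_fop lower_query.
Proof.
case: fopI => numI projR projC; split; first exact: numeric_lower.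
- by move=> R; apply: lower_projection.
- by move=> c; apply: lower_projection.
Qed.

(** Domain and cardinality proof are taken at [None] for every [o]: the images then share one
    universe, as [universal_persist] requires. *)
Let image_raise (A : struc tau) (o : option 'I_m) : struc sigma :=
  @image_on sigma (card A) k (D A) (q_dom_gt1 I (raise A None))
    (fun R => @sat flagged (raise A o) _ (q_rel I R))
    (fun c => @sat flagged (raise A o) _ (q_cst I c)).

Lemma image_raiseE A o : image I (raise A o) = image_raise A o.
Proof.
exact: (@eq_image_on sigma (card A) k _ _ (q_dom_gt1 I (raise A o)) _
  (fun R => @sat flagged (raise A o) _ (q_rel I R)) _
  (fun c => @sat flagged (raise A o) _ (q_cst I c)) _
  (dom_raise A o) (fun _ _ => erefl) (fun _ _ => erefl)).
Qed.

Lemma image_lower A : image lower_query A = image I (raise A None).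
Proof.
rewrite image_raiseE.
exact: (@eq_image_on sigma (card A) k _ _ (lower_dom_gt1 A) _
  (fun R => @sat tau A _ (lower (q_rel I R))) _
  (fun c => @sat tau A _ (lower (q_cst I c))) _
  (dom_lower A) (fun _ => sat_lower (A := A) _) (fun _ => sat_lower (A := A) _)).
Qed.

Lemma image_universal A (psi : fo sigma void) :
    universal psi -> #|csym sigma| + nb_rel psi < m ->
    (forall i, MOD (FO psi) (image I (raise A (Some i)))) ->
  MOD (FO psi) (image I (raise A None)).
Proof.
move=> upsi ltm; rewrite image_raiseE => satpsi.
case: fopI => _ projR projC.
apply: (@universal_persist sigma m _ (q_dom_gt1 I (raise A None))
  (fun o => @rel_on sigma (card A) k (D A)
     (fun R => @sat flagged (raise A o) _ (q_rel I R)))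
  (fun o => @cst_on sigma (card A) k (D A) (q_dom_gt1 I (raise A None))
     (fun c => @sat flagged (raise A o) _ (q_cst I c)))) => //.
- move=> R t.
  have [j jP] := @sat_raise_projection A _ _
    (fun p => tnth (elt_on (tnth t p.1)) p.2) (projR R).
  by exists j => i /jP E; rewrite !inE E.
(* Let [b] be the value of the constant with no flag raised. That [b] satisfies the defining
   projection depends on at most one flag; after raising any other, [b] still satisfies it and is
   the value by uniqueness. *)
- move=> c; have [b [[Db satb] uniqb]] := q_cst_uniq I (raise A None) c.
  have [j jP] := @sat_raise_projection A _ _ (tnth b) (projC c).
  exists j => i /jP; rewrite satb => satib; rewrite /cst_on; congr (odflt _ _).
  apply: eq_pick => x /=.
  have Dx : elt_on x \in D A by exact: Order.enum_valP.
  have [b' [_]] := q_cst_uniq I (raise A (Some i)) c; rewrite dom_raise => uniqb'.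
  have bE : b' = b by apply: uniqb'.
  apply/idP/idP => satx.
    by rewrite -(_ : b = elt_on x) // -bE; apply: uniqb'.
  by rewrite -(_ : b = elt_on x) //; apply: uniqb.
- by move=> i; have := satpsi i; rewrite image_raiseE.
Qed.

End Reduction.

(** * Adding flags to a problem in Sigma_2^p *)

Definition reduct (B : struc flagged) : struc tau :=
  Struc (card_gt1 B) (fun R => rel B (inl R)) (@cst flagged B).

Definition some_flag (B : struc flagged) : bool :=
  [exists i : 'I_m, [tuple] \in rel B (inr i)].

Lemma reduct_raise A o : reduct (raise A o) = A.
Proof. by case: A. Qed.

Lemma some_flag_raise A o : some_flag (raise A o) = (o != None).
Proof.
apply/existsP/idP => [[i]|] /=; first by case: o => //=; rewrite inE.
by case: o => // i _; exists i; rewrite (eqxx (Some i)) inE.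
Qed.

(** The condition on flags is first order and does not mention the quantified relations, so it can
    be moved as a disjunct inside the second-order prefix. *)
Lemma Sigma2p_flagged (P : problem tau) :
  Sigma2p P -> Sigma2p (fun B => P (reduct B) \/ some_flag B).
Proof.
case=> _ [m1 [a1 [m2 [a2 [phi ->]]]]] PE.
pose source := expand_vocab (expand_vocab tau a1) a2.
pose target := expand_vocab (expand_vocab flagged a1) a2.
pose H W (R : rsym source) :
    (arity R).-tuple (term target W) -> fo target W :=
  match R with
  | inl (inl R) => fun ts => @Rel target W (inl (inl (inl R))) ts
  | inl (inr i) => fun ts => @Rel target W (inl (inr i)) ts
  | inr i => fun ts => @Rel target W (inr i) ts
  end.
pose flags : fo target void :=
  foldr (fun i f => Or (@Rel target void (inl (inl (inr i))) [tuple]) f)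
    (Eq Zero One) (enum 'I_m).
exists (SEx (SAll (FO (Or (@trans source target id H void phi) flags)))).
  by exists m1, a1, m2, a2, (Or (@trans source target id H void phi) flags).
move=> B.
have flagsE (X : forall i, {set (a1 i).-tuple 'I_(card B)})
    (Y : forall i, {set (a2 i).-tuple 'I_(card B)}) :
    @sat target (@expand _ _ a2 (@expand _ _ a1 B X) Y) _ flags
      (@of_void 'I_(card B)) = some_flag B.
  have -> : some_flag B = has (fun i : 'I_m => [tuple] \in rel B (inr i)) (enum 'I_m).
    apply/existsP/hasP => [[i Bi]|[i _ Bi]]; exists i => //.
    by rewrite mem_enum.
  rewrite /flags; elim: (enum _) => [|i s IHs] /=; first exact/negbTE.
  rewrite IHs; congr (_ || _); apply: (congr1 (fun u => u \in rel B (inr i))).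
  exact: tuple0.
have transE (X : forall i, {set (a1 i).-tuple 'I_(card B)})
    (Y : forall i, {set (a2 i).-tuple 'I_(card B)}) :
    @sat target (@expand _ _ a2 (@expand _ _ a1 B X) Y) _
      (@trans source target id H void phi) (@of_void 'I_(card B)) =
    @sat _ (@expand _ _ a2 (@expand _ _ a1 (reduct B) X) Y) _ phi
      (@of_void 'I_(card B)).
  apply: (@sat_trans source target id H (@expand _ _ a2 (@expand _ _ a1 B X) Y)
    (@rel _ (@expand _ _ a2 (@expand _ _ a1 (reduct B) X) Y))
    (@cst _ (@expand _ _ a2 (@expand _ _ a1 (reduct B) X) Y))) => //.
  by move=> W [[R|i]|i] ts e.
split=> [[/PE[X XP]|flagB]|[X XP]].
- by exists X => Y; rewrite /= transE XP.
(* With a flag raised the matrix is true for any choice of relations. *)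
- by exists (fun=> set0) => Y; rewrite /= flagsE flagB orbT.
- case: (boolP (some_flag B)) => [|noflag]; [by right | left].
  by apply/PE; exists X => Y; have /= := XP Y; rewrite flagsE transE (negPf noflag) orbF.
Qed.

End Flags.

(** * Completeness without the universal conjunct *)

Theorem theorem4 (tau : vocab) (Psi : so tau) (psi : fo tau void) :
  Sigma2_form Psi -> universal psi ->
  Sigma2p_complete (MOD (SAnd Psi (FO psi))) -> Sigma2p_complete (MOD Psi).
Proof.
move=> Sigma2_Psi upsi [_ hard]; split; first by exists Psi.
(* One flag more than the constants and relation atoms that can each block one. *)
move=> tau' P /(@Sigma2p_flagged _ (#|csym tau| + nb_rel psi).+1) /hard.
case=> k [I [fopI redI]]; exists k, (lower_query I); split.
  exact: lower_fop.
move=> A; rewrite (image_lower fopI).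
have psiA : MOD (FO psi) (image I (raise A None)).
  apply: image_universal => // i.
  (* A raised flag alone puts the structure into the flagged problem, so its image satisfies
     [psi]. *)
  have /redI[//] : P (reduct (raise A (Some i))) \/ some_flag (raise A (Some i)).
  by right; rewrite some_flag_raise.
have := redI (raise A None); rewrite reduct_raise some_flag_raise /=.
(* With no flag raised the flagged problem is [P], and [psiA] supplies the conjunct [psi] in the
   backward direction. *)
move=> [PtoI ItoP]; split=> [PA|PsiA]; first by case: PtoI => //; left.
by case: ItoP.
Qed.
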